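(* Let $\varphi\in[0,2\pi)$, $a,b\in\mathbb{C}$, $c,k,m\in\mathbb{R}$, and $$L=T_2\begin{pmatrix} a&b&0&0\\ e^{2ik}\bar b&a+me^{ik}&0&0\\ 0&0&c&0\\ 0&0&0&c\end{pmatrix}T_2^\dagger,\qquad T_2=\begin{pmatrix}1&0&0&0\\ 0&\frac1{\sqrt2}&\frac1{\sqrt2}&0\\ 0&-\frac{e^{i\varphi}}{\sqrt2}&\frac{e^{i\varphi}}{\sqrt2}&0\\ 0&0&0&1\end{pmatrix}.$$ Let $|\psi_1\rangle=\frac1{\sqrt2}(|01\rangle+e^{i\varphi}|10\rangle)$, $|\psi_2\rangle=\frac1{\sqrt2}(|01\rangle-e^{i\varphi}|10\rangle)$, $\tilde Q=|00\rangle\langle00|+|\psi_2\rangle\langle\psi_2|$. (i) If $b\neq0$, then the attractor space of the semigroup generated by $L$ and $H$ has the orthonormal (Hilbert–Schmidt) basis $$|11\rangle\langle11|,\ |\psi_1\rangle\langle\psi_1|,\ |11\rangle\langle\psi_1|,\ |\psi_1\rangle\langle11|,\ \tfrac1{\sqrt2}\tilde Q,$$ whose elements are eigenvectors of $\mathcal L$ with eigenvalues $0,0,i\Delta E,-i\Delta E,0$ respectively. (ii) If $b=0$, $a+me^{ik}\neq c$, $m\neq0$ and $a\neq c$, then the attractor space has the orthonormal basis $$|11\rangle\langle11|,\ |\psi_1\rangle\langle\psi_1|,\ |11\rangle\langle\psi_1|,\ |\psi_1\rangle\langle11|,\ |\psi_2\rangle\langle\psi_2|,\ |00\rangle\langle00|,$$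 with eigenvalues $0,0,i\Delta E,-i\Delta E,0,0$ respectively.
   Context: Hilbert space $\mathbb{C}^2\otimes\mathbb{C}^2$, $|ij\rangle=|i\rangle\otimes|j\rangle$; matrices are in the ordered basis $(|00\rangle,|01\rangle,|10\rangle,|11\rangle)$. $H=H_0\otimes I+I\otimes H_0$ with $H_0=\mathrm{diag}(E_0,E_1)$, $E_0,E_1\in\mathbb{R}$, $\Delta E=E_0-E_1\neq0$. The generator is $\mathcal L(\rho)=-i[H,\rho]+L\rho L^\dagger-\frac12\{L^\dagger L,\rho\}$. The attractor space is the direct sum of $\ker(\mathcal L-\lambda I)$ over all purely imaginary eigenvalues $\lambda$ (including $0$) of $\mathcal L$. *)

(* Defs.v *)
From HB Require Import structures.
From mathcomp Require Import all_boot all_order all_algebra.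
From mathcomp Require Import spectral sesquilinear.
From mathcomp Require Import mxtens complex.
From mathcomp Require Import boolp classical_sets cardinality fsbigop.
From mathcomp Require Import reals trigo.
From mathcomp Require Import ring.

Set Implicit Arguments.
Unset Strict Implicit.
Unset Printing Implicit Defensive.

Import Order.TTheory GRing.Theory Num.Theory passmx.

Local Open Scope classical_set_scope.
Local Open Scope ring_scope.
Local Open Scope sesquilinear_scope.

Section Lindblad.
Variables (C : numClosedFieldType) (n : nat).
Implicit Types (H L X : 'M[C]_n).

Definition lindblad H L X : 'M[C]_n :=
  - 'i *: (H *m X - X *m H) + L *m X *m L ^t*
  - 2^-1 *: (L ^t* *m L *m X + X *m (L ^t* *m L)).

Lemma lindblad_is_linear H L : linear (lindblad H L).
Proof.
move=> a X Y; rewrite /lindblad !(mulmxDr, mulmxDl) -!(scalemxAl, scalemxAr).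
by apply/matrixP => i j; rewrite !mxE; ring.
Qed.

HB.instance Definition _ H L :=
  GRing.isLinear.Build C 'M[C]_n 'M[C]_n *:%R (lindblad H L)
    (lindblad_is_linear H L).

Definition generator H L : 'End('M[C]_n) := linfun (lindblad H L).

Definition ketbra (u v : 'cV[C]_n) : 'M[C]_n := u *m v ^t*.

(* Hilbert-Schmidt inner product, antilinear in the first argument *)
Definition hs_dot X Y : C := \tr (X ^t* *m Y).

Definition hs_orthonormal (s : seq 'M[C]_n) : Prop :=
  forall i j, (i < size s)%N -> (j < size s)%N ->
    hs_dot s`_i s`_j = (i == j)%:R.

End Lindblad.

Section Attractor.
Variables (C : numClosedFieldType) (vT : vectType C).

(* 0 counts as purely imaginary *)
Definition imaginary_eigenvalues (f : 'End(vT)) : set C :=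
  [set l | leigenvalue f l /\ 'Re l = 0].

Lemma finite_imaginary_eigenvalues f : finite_set (imaginary_eigenvalues f).
Proof.
have e_basis := vbasisP {:vT}; set e := vbasis _ in e_basis.
pose M := mxof e e f.
have [rs Ers] := closed_field_poly_normal (char_poly M).
apply: (@sub_finite_set _ _ [set` rs]); last exact: finite_seq.
move=> l [+ _] /=; rewrite /leigenvalue (leigenspaceE e_basis) => fl.
have : eigenvalue M l by apply: contraNN fl => /eqP ->; rewrite vsof0.
rewrite eigenvalue_root_char Ers (monicP (char_poly_monic _)) scale1r.
by rewrite root_prod_XsubC.
Qed.

(* The finitely supported sum would be 0 over an infinite index set;
   finite_imaginary_eigenvalues rules that out. Eigenspaces of distinct
   eigenvalues are independent, so the sum is direct. *)
Definition attractor (f : 'End(vT)) : {vspace vT} :=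
  \big[addv/0%VS]_(l \in imaginary_eigenvalues f) leigenspace f l.

End Attractor.

Definition is_eigenvector (C : fieldType) (vT : vectType C)
  (f : 'End(vT)) (l : C) (v : vT) : Prop := v != 0 /\ f v = l *: v.

(* B lists the orthonormal basis vectors together with their eigenvalues. *)
Definition attractor_onb (C : numClosedFieldType) (n : nat) (H L : 'M[C]_n)
    (B : seq ('M[C]_n * C)) : Prop :=
  [/\ basis_of (attractor (generator H L)) (unzip1 B),
      hs_orthonormal (unzip1 B)
    & forall X l, (X, l) \in B -> is_eigenvector (generator H L) l X].

Section TwoQubits.
Variable R : realType.
Local Notation C := R[i].

Definition expi (t : R) : C := (cos t +i* sin t)%C.

Definition rsqrt2 : C := ((Num.sqrt 2)^-1)%:C%C.

Definition mx4 (rows : seq (seq C)) : 'M[C]_4 :=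
  \matrix_(i, j) (nth [::] rows i)`_j.

(* *t enumerates pairs (i, j) lexicographically: 00, 01, 10, 11 *)
Definition ket2 (i j : 'I_2) : 'cV[C]_4 :=
  (delta_mx i 0 : 'cV[C]_2) *t (delta_mx j 0 : 'cV[C]_2).

Definition ket00 := ket2 0 0.
Definition ket01 := ket2 0 1.
Definition ket10 := ket2 1 0.
Definition ket11 := ket2 1 1.

Definition hamiltonian1 (E0 E1 : R) : 'M[C]_2 :=
  diag_mx (\row_j (if j == 0 then E0%:C%C else E1%:C%C)).

Definition hamiltonian (E0 E1 : R) : 'M[C]_4 :=
  hamiltonian1 E0 E1 *t 1%:M + 1%:M *t hamiltonian1 E0 E1.

Definition psi1 (phi : R) : 'cV[C]_4 :=
  rsqrt2 *: (ket01 + expi phi *: ket10).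
Definition psi2 (phi : R) : 'cV[C]_4 :=
  rsqrt2 *: (ket01 - expi phi *: ket10).

Definition Qt (phi : R) : 'M[C]_4 :=
  ketbra ket00 ket00 + ketbra (psi2 phi) (psi2 phi).

Definition T2 (phi : R) : 'M[C]_4 := mx4
  [:: [:: 1; 0;                      0;                    0];
      [:: 0; rsqrt2;                 rsqrt2;               0];
      [:: 0; - (expi phi * rsqrt2);  expi phi * rsqrt2;    0];
      [:: 0; 0;                      0;                    1]].

Definition lindblad_op (phi : R) (a b : C) (c k m : R) : 'M[C]_4 :=
  T2 phi *m
  mx4 [:: [:: a;                    b;                        0;      0];
          [:: expi (2 * k) * b^*;   a + m%:C%C * expi k;      0;      0];
          [:: 0;                    0;                        c%:C%C; 0];
          [:: 0;                    0;                        0;      c%:C%C]]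
  *m (T2 phi) ^t*.

End TwoQubits.

(* Main.v *)
(** For normal [L] and Hermitian [H] one has
    [2 Re <X, lindblad H L X> = - |[L, X]|^2], so an eigenvector for a purely
    imaginary eigenvalue commutes with [L], hence also with [L ^t*]; the
    dissipator then vanishes on it and only [- 'i [H, X] = l X] remains.
    Conversely every such [X] is an eigenvector, so the attractor space is
    spanned by the eigenmatrices of [[H, -]] commuting with [L].
    In the orthonormal frame [|00>, psi2, psi1, |11>] given by the columns of
    [T2], [H] is diagonal and [L] is block diagonal; comparing entries of
    [L X = X L], and using that two entries of [X] with different energy gaps
    cannot both be nonzero, yields the two bases. *)

Require Import Defs.
From mathcomp Require Import all_boot all_order all_algebra.
From mathcomp Require Import spectral sesquilinear.
From mathcomp Require Import mxtens complex.
From mathcomp Require Import boolp classical_sets cardinality fsbigop.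
From mathcomp Require Import reals trigo ring.

Import Order.TTheory GRing.Theory Num.Theory passmx.
Local Open Scope ring_scope.
Local Open Scope sesquilinear_scope.

(** * Hilbert-Schmidt product, and purely imaginary eigenvalues for a normal Lindblad operator *)

Section HilbertSchmidt.
Variables (C : numClosedFieldType) (n : nat).
Implicit Types (X Y Z L H U : 'M[C]_n) (s : seq 'M[C]_n).

Lemma trmxC_mul m p q (A : 'M[C]_(m, p)) (B : 'M[C]_(p, q)) :
  (A *m B) ^t* = B ^t* *m A ^t*.
Proof. by rewrite trmx_mul map_mxM. Qed.

Lemma trmxCK m p (A : 'M[C]_(m, p)) : A ^t* ^t* = A.
Proof. by apply/matrixP => i j; rewrite !mxE conjCK. Qed.

Lemma trmxCD m p (A B : 'M[C]_(m, p)) : (A + B) ^t* = A ^t* + B ^t*.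
Proof. by rewrite linearD map_mxD. Qed.

Lemma trmxCN m p (A : 'M[C]_(m, p)) : (- A) ^t* = - A ^t*.
Proof. by rewrite linearN map_mxN. Qed.

Lemma trmxCZ m p a (A : 'M[C]_(m, p)) : (a *: A) ^t* = a^* *: A ^t*.
Proof. by rewrite linearZ map_mxZ. Qed.

Lemma mxtraceC X : \tr (X ^t*) = (\tr X)^*.
Proof. by rewrite -mxtrace_tr rmorph_sum; apply: eq_bigr => i _; rewrite !mxE. Qed.

Lemma hs_dot_ge0 X : 0 <= hs_dot X X.
Proof.
apply: sumr_ge0 => i _; rewrite mxE; apply: sumr_ge0 => j _.
by rewrite !mxE mulrC mul_conjC_ge0.
Qed.

Lemma hs_dot_eq0 X : (hs_dot X X == 0) = (X == 0).
Proof.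
apply/idP/eqP => [|->]; last by rewrite /hs_dot mulmx0 mxtrace0.
have ge0 (i j : 'I_n) : 0 <= X ^t* i j * X j i by rewrite !mxE mulrC mul_conjC_ge0.
have -> : hs_dot X X = \sum_i \sum_j X ^t* i j * X j i.
  by apply: eq_bigr => i _; rewrite mxE.
rewrite psumr_eq0 => [/allP X0|i _]; last exact: sumr_ge0.
apply/matrixP => i j; have /= := X0 j (mem_index_enum _).
rewrite psumr_eq0 => // /allP/(_ i (mem_index_enum _)) /=.
by rewrite !mxE mulrC mul_conjC_eq0 => /eqP.
Qed.

Lemma hs_orthonormal_free s : hs_orthonormal s -> free s.
Proof.
move=> s_on; apply/(@freeP _ _ _ (in_tuple s)) => k k0 i.
have <- : hs_dot s`_i (\sum_j k j *: s`_j) = k i.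
  rewrite /hs_dot mulmx_sumr raddf_sum (bigD1 i) //= big1 ?addr0 => [|j ji].
    by rewrite -scalemxAr mxtraceZ [\tr _]s_on // eqxx mulr1.
  rewrite -scalemxAr mxtraceZ [\tr _]s_on // -val_eqE eq_sym in ji *.
  by rewrite (negPf ji) mulr0.
by rewrite k0 /hs_dot mulmx0 mxtrace0.
Qed.

(** For Hermitian [H] the traces paired with [H] are real, so their multiples by ['i] cancel against
    the conjugates. The remaining traces match by cyclicity; normality is what turns the trace of
    [L ^t* L X ^t* X] into that of [L ^t* X ^t* X L]. *)
Lemma hs_dot_lindblad H L X : H ^t* = H -> L \is normalmx ->
  hs_dot X (lindblad H L X) + (hs_dot X (lindblad H L X))^* =
  - hs_dot (L *m X - X *m L) (L *m X - X *m L).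
Proof.
move=> Hh /normalmxP Ln; rewrite -mxtraceC /hs_dot /lindblad.
rewrite !(trmxCD, trmxCZ, trmxCN, trmxC_mul, trmxCK) Hh.
rewrite ?rmorphN ?conjCi ?opprK fmorphV rmorph_nat.
rewrite !(mulmxDl, mulmxDr, mulmxN, mulNmx) -?(scalemxAl, scalemxAr).
rewrite !(mulmxDl, mulmxDr, mulmxN, mulNmx) !mulmxA.
rewrite !(mxtraceD, mxtraceZ, raddfN) /= !(mxtraceD, mxtraceZ, raddfN) /=.
have -> : \tr (X ^t* *m L *m X *m L ^t*) = \tr (L ^t* *m X ^t* *m L *m X).
  by rewrite mxtrace_mulC !mulmxA.
have -> : \tr (H *m X ^t* *m X) = \tr (X ^t* *m X *m H).
  by rewrite -mulmxA mxtrace_mulC.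
have -> : \tr (L *m X ^t* *m L ^t* *m X) = \tr (X ^t* *m L ^t* *m X *m L).
  by rewrite -!mulmxA mxtrace_mulC !mulmxA.
have e1 : \tr (L ^t* *m L *m X ^t* *m X) = \tr (L ^t* *m X ^t* *m X *m L).
  by rewrite -Ln -!mulmxA mxtrace_mulC !mulmxA.
have -> : \tr (X ^t* *m X *m L ^t* *m L) = \tr (L ^t* *m X ^t* *m X *m L).
  by rewrite -e1 -mulmxA mxtrace_mulC mulmxA.
by rewrite e1 conjCi; field.
Qed.

(** Fuglede's theorem in finite dimension. The squared norm of [L ^t* X - X L ^t*] expands into four
    traces; normality swaps [L] with [L ^t*] so that [LX] applies, and the traces cancel in
    pairs. *)
Lemma normal_commC L X : L \is normalmx ->
  L *m X = X *m L -> L ^t* *m X = X *m L ^t*.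
Proof.
move=> /normalmxP Ln LX.
apply/eqP; rewrite -subr_eq0 -hs_dot_eq0; apply/eqP.
rewrite /hs_dot trmxCD trmxCN !trmxC_mul !trmxCK.
rewrite !(mulmxDl, mulmxDr, mulmxN, mulNmx) !mxtraceD !raddfN /= opprK.
have -> : \tr (X ^t* *m L *m (L ^t* *m X)) = \tr (L *m X ^t* *m (L ^t* *m X)).
  rewrite mulmxA -(mulmxA _ L) Ln -!mulmxA LX.
  by rewrite !mulmxA mxtrace_mulC !mulmxA.
have -> : \tr (L *m X ^t* *m (X *m L ^t*)) = \tr (X ^t* *m L *m (X *m L ^t*)).
  rewrite -mulmxA mxtrace_mulC -!mulmxA -Ln (mulmxA X) -LX.
  by rewrite !mulmxA.
by ring.
Qed.

Lemma lindblad_comm H L X : L \is normalmx -> L *m X = X *m L ->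
  lindblad H L X = - 'i *: (H *m X - X *m H).
Proof.
move=> Ln LX; have LXc := normal_commC L X Ln LX; rewrite /lindblad.
have -> : L ^t* *m L *m X = X *m (L ^t* *m L) by rewrite -mulmxA LX !mulmxA LXc.
rewrite LX -mulmxA (normalmxP Ln) -mulr2n -scaler_nat scalerA.
by rewrite mulVf ?pnatr_eq0 // scale1r addrK.
Qed.

Lemma peripheral_eigenvectorP H L X (l : C) :
  H ^t* = H -> L \is normalmx -> 'Re l = 0 -> lindblad H L X = l *: X ->
  L *m X = X *m L /\ H *m X - X *m H = ('i * l) *: X.
Proof.
move=> Hh Ln l_im Xl; have LX : L *m X = X *m L.
  (* The pairing of [X] with [l *: X] is [l] times a nonnegative real, so adding its conjugate gives
     a multiple of [l + l^*], which is zero. *)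
  apply/eqP; rewrite -subr_eq0 -hs_dot_eq0 -oppr_eq0 -(hs_dot_lindblad H) //.
  rewrite Xl /hs_dot -scalemxAr mxtraceZ rmorphM /= (geC0_conj (hs_dot_ge0 X)).
  rewrite -mulrDl; have /eqP := l_im.
  by rewrite ReE mulf_eq0 invr_eq0 pnatr_eq0 orbF => /eqP ->; rewrite mul0r.
split=> //; move: Xl; rewrite lindblad_comm // => /(congr1 ( *:%R 'i)).
by rewrite !scalerA mulrN -expr2 sqrCi opprK scale1r.
Qed.

Lemma ketbraM U (u v : 'cV[C]_n) :
  ketbra (U *m u) (U *m v) = U *m ketbra u v *m U ^t*.
Proof. by rewrite /ketbra trmxC_mul !mulmxA. Qed.

Lemma trmxC_delta m p (i : 'I_m) (j : 'I_p) :
  (delta_mx i j : 'M[C]_(m, p)) ^t* = delta_mx j i.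
Proof. by rewrite trmx_delta map_delta_mx. Qed.

Lemma ketbra_delta (i j : 'I_n) :
  ketbra (delta_mx i 0) (delta_mx j 0) = delta_mx i j :> 'M[C]_n.
Proof. by rewrite /ketbra trmxC_delta mul_delta_mx. Qed.

Lemma hs_dot_delta (i j k l : 'I_n) :
  hs_dot (delta_mx i j : 'M[C]_n) (delta_mx k l) = ((i == k) && (j == l))%:R.
Proof.
rewrite /hs_dot trmxC_delta mul_delta_mx_cond raddfMn /= [\tr _](bigD1 j) //=.
rewrite big1 => [|h hj]; last by rewrite mxE (negPf hj).
by rewrite mxE eqxx addr0 -mulrnA; case: (i == k); case: (j == l).
Qed.

Lemma hs_dotC X Y : hs_dot Y X = (hs_dot X Y)^*.
Proof. by rewrite /hs_dot -mxtraceC trmxC_mul trmxCK. Qed.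

Lemma hs_dotDr X Y Z : hs_dot X (Y + Z) = hs_dot X Y + hs_dot X Z.
Proof. by rewrite /hs_dot mulmxDr mxtraceD. Qed.

Lemma hs_dotZr X Y c : hs_dot X (c *: Y) = c * hs_dot X Y.
Proof. by rewrite /hs_dot -scalemxAr mxtraceZ. Qed.

(** Serves to adjoin the normalized [Qt], the one basis element that is not a matrix unit in the
    frame of [T2]. *)
Lemma hs_orthonormal_rcons s X : hs_orthonormal s ->
    {in s, forall Y, hs_dot Y X = 0} -> hs_dot X X = 1 ->
  hs_orthonormal (rcons s X).
Proof.
move=> s_on sX X1 i j; rewrite size_rcons !ltnS !nth_rcons.
rewrite leq_eqVlt => /orP[/eqP-> | i_lt]; rewrite leq_eqVlt => /orP[/eqP-> | j_lt].
- by rewrite ltnn !eqxx.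
- rewrite ltnn eqxx j_lt hs_dotC sX ?mem_nth // conjC0.
  by rewrite eq_sym (ltn_eqF j_lt).
- by rewrite ltnn eqxx i_lt sX ?mem_nth // (ltn_eqF i_lt).
by rewrite i_lt j_lt s_on.
Qed.
End HilbertSchmidt.

(** * Attractor space from the commutant, and transport along a unitary *)

Section Attractor.
Variable C : numClosedFieldType.

Lemma mem_leigenspace (vT : vectType C) (f : 'End(vT)) l v :
  (v \in leigenspace f l) = (f v == l *: v).
Proof. by rewrite memv_ker add_lfunE opp_lfunE scale_lfunE id_lfunE subr_eq0. Qed.

Lemma attractor_subv (vT : vectType C) (f : 'End(vT)) (V : {vspace vT}) :
    (forall l v, 'Re l = 0 -> f v = l *: v -> v \in V) ->
  (attractor f <= V)%VS.
Proof.
move=> fV; have fin := finite_imaginary_eigenvalues f.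
rewrite /attractor (fsbig_finite _ _ fin) /= big_seq.
elim/big_ind: _ => [|W1 W2|l]; first exact: sub0v.
  by rewrite subv_add => -> ->.
rewrite in_fset_set // => /set_mem [_ l_im]; apply/subvP => v.
by rewrite mem_leigenspace => /eqP/fV; apply.
Qed.

Lemma mem_attractor (vT : vectType C) (f : 'End(vT)) l v :
  'Re l = 0 -> f v = l *: v -> v \in attractor f.
Proof.
(* The zero vector is set apart because [l] need not be an eigenvalue then. *)
move=> l_im fv; have [->|v0] := eqVneq v 0; first exact: mem0v.
have vl : v \in leigenspace f l by rewrite mem_leigenspace fv.
have fl : imaginary_eigenvalues f l.
  split=> //; apply: contraNneq v0 => f0.
  by move: vl; rewrite f0 memv0.
rewrite /attractor (fsbigD1 l) //=; last exact: finite_imaginary_eigenvalues.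
exact: subvP (addvSl _ _) _ vl.
Qed.

(** The factor ['i * l] is the commutator form of the eigenvalue: on the commutant of [L] the
    generator is [- 'i] times the commutator with [H], and [- 'i * 'i = 1]. Orthonormality gives
    freeness, so only the two inclusions of spans remain. *)
Lemma attractor_onb_of_commutant n (H L : 'M[C]_n) (B : seq ('M[C]_n * C)) :
    H ^t* = H -> L \is normalmx -> hs_orthonormal (unzip1 B) ->
    (forall X l, (X, l) \in B ->
      [/\ 'Re l = 0, L *m X = X *m L & H *m X - X *m H = ('i * l) *: X]) ->
    (forall X mu, L *m X = X *m L -> H *m X - X *m H = mu *: X ->
      X \in <<unzip1 B>>%VS) ->
  attractor_onb H L B.
Proof.
move=> Hh Ln B_on B_eig B_span.
have gen X l : (X, l) \in B -> generator H L X = l *: X.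
  case/B_eig => _ LX HX; rewrite lfunE /= lindblad_comm // HX scalerA mulrA.
  by rewrite mulNr -expr2 sqrCi opprK mul1r.
split=> // [|X l XB]; last first.
  split; last exact: gen.
  have XB1 : X \in unzip1 B by apply/mapP; exists (X, l).
  have i_lt : (index X (unzip1 B) < size (unzip1 B))%N by rewrite index_mem.
  have := B_on _ _ i_lt i_lt; rewrite nth_index // eqxx -hs_dot_eq0 => ->.
  exact: oner_neq0.
rewrite /basis_of hs_orthonormal_free // andbT eqEsubv; apply/andP; split.
  apply/span_subvP => _ /mapP[[X l] XB ->] /=.
  by apply: (@mem_attractor _ _ l); [case: (B_eig _ _ XB)|exact: gen].
apply: attractor_subv => l X l_im; rewrite lfunE /= => Xl.
by have [] := @peripheral_eigenvectorP _ _ H L X l Hh Ln l_im Xl; exact: B_span.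
Qed.

(** Conjugation by a unitary is a bijective algebra morphism preserving adjoints and the
    Hilbert-Schmidt product, so all hypotheses can be checked in the frame where [L] is simple. *)
Lemma attractor_onb_conj n (U H L : 'M[C]_n) (B : seq ('M[C]_n * C)) :
    U \is unitarymx -> H ^t* = H -> L \is normalmx ->
    hs_orthonormal (unzip1 B) ->
    (forall X l, (X, l) \in B ->
      [/\ 'Re l = 0, L *m X = X *m L & H *m X - X *m H = ('i * l) *: X]) ->
    (forall X mu, L *m X = X *m L -> H *m X - X *m H = mu *: X ->
      X \in <<unzip1 B>>%VS) ->
  attractor_onb (U *m H *m U ^t*) (U *m L *m U ^t*)
    [seq (U *m x.1 *m U ^t*, x.2) | x <- B].
Proof.
move=> Uu Hh Ln B_on B_eig B_span; pose cj X := U *m X *m U ^t*.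
have UU : U ^t* *m U = 1%:M by rewrite -invmx_unitary // mulVmx // unitarymx_unit.
have cjM X Y : cj X *m cj Y = cj (X *m Y).
  by rewrite /cj -!mulmxA (mulmxA _ U) UU mul1mx !mulmxA.
have cjB X Y : cj X - cj Y = cj (X - Y) by rewrite /cj mulmxBr mulmxBl.
have cjZ a X : a *: cj X = cj (a *: X) by rewrite /cj -scalemxAr scalemxAl.
have cjC X : (cj X) ^t* = cj (X ^t*).
  by rewrite /cj !trmxC_mul trmxCK mulmxA.
have cjI : injective cj.
  move=> X Y /(congr1 (fun Z => U ^t* *m Z *m U)).
  by rewrite /cj !mulmxA UU !mul1mx -!mulmxA UU !mulmx1.
have cjK X : cj (U ^t* *m X *m U) = X.
  by rewrite /cj !mulmxA (unitarymxP Uu) mul1mx -mulmxA (unitarymxP Uu) mulmx1.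
have uzE : unzip1 [seq (cj x.1, x.2) | x <- B] = map cj (unzip1 B).
  by rewrite /unzip1 -!map_comp.
apply: attractor_onb_of_commutant.
- by rewrite cjC Hh.
- by apply/normalmxP; rewrite -/(cj L) cjC !cjM (normalmxP Ln).
- move=> i j; rewrite uzE size_map => iB jB; rewrite !(nth_map (0 : 'M[C]_n)) //.
  rewrite /hs_dot cjC cjM /cj mxtrace_mulC [U ^t* *m _]mulmxA UU mul1mx; exact: B_on.
- move=> _ l /mapP[[X l'] XB [-> ->]] /=; have [l_im LX HX] := B_eig _ _ XB.
  by split; rewrite // !cjM ?LX // cjB HX -cjZ.
move=> X mu; rewrite -[X]cjK; move: (_ *m _ *m U) => {}X.
rewrite !cjM cjB cjZ => /cjI LX /cjI HX; have := B_span X mu LX HX.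
(* Packaged as a linear map, conjugation commutes with taking spans. *)
rewrite uzE; pose f := linfun (mulmxr (U ^t*) \o mulmx U).
have -> : map cj (unzip1 B) = map f (unzip1 B).
  by apply: eq_map => Y; rewrite lfunE.
rewrite -limg_span => /(memv_img f); by rewrite lfunE.
Qed.
End Attractor.

(** * Commutators with a diagonal matrix *)

Section DiagonalCommutator.
Variables (F : fieldType) (n : nat) (d : 'rV[F]_n).
Implicit Types X : 'M[F]_n.

Lemma diag_mx_commutatorE X i j :
  (diag_mx d *m X - X *m diag_mx d) i j = (d 0 i - d 0 j) * X i j.
Proof. by rewrite mul_diag_mx mul_mx_diag !mxE mulrBl (mulrC (X i j)). Qed.

Lemma diag_mx_commutator_delta i j :
  diag_mx d *m delta_mx i j - delta_mx i j *m diag_mx d =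
  (d 0 i - d 0 j) *: delta_mx i j.
Proof.
apply/matrixP => k l; rewrite diag_mx_commutatorE !mxE.
by case: (k =P i) => [->|_]; case: (l =P j) => [->|_]; rewrite ?mulr0.
Qed.

Lemma diag_mx_commutator_disjoint X mu i j k l :
    diag_mx d *m X - X *m diag_mx d = mu *: X ->
    d 0 i - d 0 j != d 0 k - d 0 l ->
  X i j = 0 \/ X k l = 0.
Proof.
move=> HX; have entry p q : X p q != 0 -> d 0 p - d 0 q = mu.
  by move=> Xpq; apply: (mulIf Xpq); rewrite -diag_mx_commutatorE HX mxE.
have [->|/entry ->] := eqVneq (X i j) 0; first by left.
by have [->|/entry ->] := eqVneq (X k l) 0; [right | rewrite eqxx].
Qed.

(** An eigenvector of a 2 by 2 matrix with nonzero off-diagonal entries cannot have exactly one zero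
    coordinate. *)
Lemma coupled_vanish (x y p q r s c : F) :
    x = 0 \/ y = 0 -> q != 0 -> r != 0 ->
    p * x + q * y = c * x -> r * x + s * y = c * y ->
  x = 0 /\ y = 0.
Proof.
move=> [->|->] q0 r0; rewrite !mulr0 ?add0r ?addr0 => /eqP + /eqP.
  by rewrite mulf_eq0 (negPf q0) => /eqP ->.
by rewrite !mulf_eq0 (negPf r0) => _ /eqP ->.
Qed.
End DiagonalCommutator.

(** * Explicit indices in dimension four, on which list lookups reduce by computation *)

Definition o0 : 'I_4 := @Ordinal 4 0 isT.
Definition o1 : 'I_4 := @Ordinal 4 1 isT.
Definition o2 : 'I_4 := @Ordinal 4 2 isT.
Definition o3 : 'I_4 := @Ordinal 4 3 isT.

Lemma ord4_ind (P : 'I_4 -> Prop) : P o0 -> P o1 -> P o2 -> P o3 -> forall i, P i.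
Proof.
move=> P0 P1 P2 P3 [[|[|[|[|//]]]] lt_i].
- by rewrite (_ : Ordinal lt_i = o0) //; apply: val_inj.
- by rewrite (_ : Ordinal lt_i = o1) //; apply: val_inj.
- by rewrite (_ : Ordinal lt_i = o2) //; apply: val_inj.
- by rewrite (_ : Ordinal lt_i = o3) //; apply: val_inj.
Qed.

Lemma sum_ord4 (V : nmodType) (F : 'I_4 -> V) :
  \sum_i F i = F o0 + F o1 + F o2 + F o3.
Proof.
rewrite !big_ord_recl big_ord0 addr0 !addrA.
by congr (F _ + F _ + F _ + F _); apply: val_inj.
Qed.

(** * Phases, the unitary [T2], the Hamiltonian and the basis vectors *)

Section TwoQubits.
Variable R : realType.
Local Notation C := R[i].
Implicit Types (phi k m c : R) (a b : C).

Lemma expi_neq0 phi : expi phi != 0.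
Proof.
rewrite eq_complex /=; apply/negP => /andP[/eqP c0 /eqP s0].
by have := cos2Dsin2 phi; rewrite c0 s0 expr0n add0r => /esym/eqP; rewrite oner_eq0.
Qed.

Lemma conj_expi phi : (expi phi)^* = (expi phi)^-1.
Proof.
apply: (mulfI (expi_neq0 phi)); rewrite divff ?expi_neq0 //.
apply/eqP; rewrite eq_complex /=; apply/andP; split; apply/eqP.
  by rewrite mulrN opprK -!expr2 cos2Dsin2.
by rewrite mulrN mulrC addNr.
Qed.

Lemma expi2 phi : expi (2 * phi) = expi phi ^+ 2.
Proof.
rewrite expr2 mulr_natl mulr2n /expi cosD sinD.
by apply/eqP; rewrite eq_complex /= (mulrC (cos phi) (sin phi)) !eqxx.
Qed.

Lemma conj_real (x : R) : (x%:C%C)^* = x%:C%C.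
Proof. exact: conjc_real. Qed.

Lemma conj_rsqrt2 : (rsqrt2 R)^* = rsqrt2 R.
Proof. exact: conj_real. Qed.

Lemma rsqrt2M : rsqrt2 R * rsqrt2 R = 2^-1.
Proof.
rewrite -rmorphM /= -invfM -expr2 sqr_sqrtr ?ler0n // fmorphV.
by rewrite rmorph_nat.
Qed.

Lemma mulmx4E p q (A : 'M[C]_(p, 4)) (B : 'M[C]_(4, q)) i j :
  (A *m B) i j = A i o0 * B o0 j + A i o1 * B o1 j + A i o2 * B o2 j + A i o3 * B o3 j.
Proof. by rewrite mxE sum_ord4. Qed.

(* Rewriting with [rmorphM] and its kin would leave [Num.conj] in bundled form,
   which the rules for [_^*] no longer match. *)
Lemma conjCN (x : C) : (- x)^* = - x^*. Proof. exact: rmorphN. Qed.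
Lemma conjCD (x y : C) : (x + y)^* = x^* + y^*. Proof. exact: rmorphD. Qed.
Lemma conjCM (x y : C) : (x * y)^* = x^* * y^*. Proof. exact: rmorphM. Qed.

Local Notation conjE := (conjC0, conjC1, conjCN, conjCD, conjCM, conj_real,
  conj_expi, conj_rsqrt2, conjCK).
Local Notation simpE := (mul0r, mulr0, mul1r, mulr1, add0r, addr0, oppr0, subrr, sub0r).

Lemma rsqrt2_neq0 : rsqrt2 R != 0.
Proof. by rewrite fmorph_eq0 invr_eq0 sqrtr_eq0 -ltNge ltr0n. Qed.

Lemma T2_unitary phi : T2 phi \is unitarymx.
Proof.
have e0 := expi_neq0 phi.
apply/unitarymxP/matrixP => i j; rewrite mulmx4E.
elim/ord4_ind: i; elim/ord4_ind: j; rewrite !mxE /= !conjE !simpE //.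
- by rewrite !rsqrt2M; field.
- by rewrite mulrN addNr.
- by rewrite mulNr addNr.
by rewrite mulrNN mulrACA divff // mul1r !rsqrt2M; field.
Qed.

Definition energies E0 E1 : 'rV[C]_4 :=
  \row_j let e0 := E0%:C%C in let e1 := E1%:C%C in
    [:: e0 + e0; e0 + e1; e0 + e1; e1 + e1]`_j.

Lemma hamiltonianE E0 E1 : hamiltonian E0 E1 = diag_mx (energies E0 E1).
Proof.
apply/matrixP => i j.
case: (@mxtens_indexP 2 2 i) => i0 i1; case: (@mxtens_indexP 2 2 j) => j0 j1.
rewrite mxE !tensmxE !mxE.
by case: i0 i1 j0 j1 => [[|[|//]] ?] [[|[|//]] ?] [[|[|//]] ?] [[|[|//]] ?];
  rewrite -?val_eqE /= ?(mulr0n, mulr1n) !simpE //= addrC.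
Qed.

(* [T2] only mixes |01> and |10>, which have the same energy. *)
Lemma hamiltonian_T2 phi E0 E1 :
  hamiltonian E0 E1 = T2 phi *m diag_mx (energies E0 E1) *m (T2 phi) ^t*.
Proof.
rewrite hamiltonianE; set D := diag_mx _.
suff -> : T2 phi *m D = D *m T2 phi.
  by rewrite -mulmxA (unitarymxP (T2_unitary phi)) mulmx1.
rewrite mul_diag_mx mul_mx_diag; apply/matrixP => i j.
by elim/ord4_ind: i; elim/ord4_ind: j; rewrite !mxE /= ?simpE // mulrC.
Qed.

Lemma ket2E (i j : 'I_2) : ket2 R i j = delta_mx (mxtens_index (i, j)) 0.
Proof.
apply/matrixP => k l; case: (@mxtens_indexP 2 2 k) => k0 k1.
(* The single column index is put in tensor form so that [tensmxE] applies. *)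
have -> : l = mxtens_index (0 : 'I_1, 0 : 'I_1) by rewrite [l]ord1; apply: val_inj.
rewrite [LHS](@tensmxE C 2 1 2 1) !mxE -natrM mulnb.
by rewrite (inj_eq (can_inj (@mxtens_indexK 2 2))) xpair_eqE !andbT.
Qed.

Lemma ket00E phi : ket00 R = T2 phi *m delta_mx o0 0.
Proof.
rewrite /ket00 ket2E (_ : mxtens_index _ = o0 :> 'I_(2 * 2)); last exact: val_inj.
apply/matrixP => i j; rewrite mulmx4E [j]ord1.
by elim/ord4_ind: i; rewrite !mxE /= ?simpE.
Qed.

(** The minus sign sits in the second column of [T2], so [psi2] comes before [psi1] in the frame. *)
Lemma psi2E phi : psi2 phi = T2 phi *m delta_mx o1 0.
Proof.
rewrite /psi2 /ket01 /ket10 !ket2E.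
rewrite (_ : mxtens_index _ = o1 :> 'I_(2 * 2)); last exact: val_inj.
rewrite (_ : mxtens_index _ = o2 :> 'I_(2 * 2)); last exact: val_inj.
apply/matrixP => i j; rewrite mulmx4E [j]ord1.
by elim/ord4_ind: i; rewrite !mxE /= ?simpE // mulrN mulrC.
Qed.

Lemma psi1E phi : psi1 phi = T2 phi *m delta_mx o2 0.
Proof.
rewrite /psi1 /ket01 /ket10 !ket2E.
rewrite (_ : mxtens_index _ = o1 :> 'I_(2 * 2)); last exact: val_inj.
rewrite (_ : mxtens_index _ = o2 :> 'I_(2 * 2)); last exact: val_inj.
apply/matrixP => i j; rewrite mulmx4E [j]ord1.
by elim/ord4_ind: i; rewrite !mxE /= ?simpE // mulrC.
Qed.

Lemma ket11E phi : ket11 R = T2 phi *m delta_mx o3 0.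
Proof.
rewrite /ket11 ket2E (_ : mxtens_index _ = o3 :> 'I_(2 * 2)); last exact: val_inj.
apply/matrixP => i j; rewrite mulmx4E [j]ord1.
by elim/ord4_ind: i; rewrite !mxE /= ?simpE.
Qed.

(** * Normality and commutant of the block operator *)

Definition block_op a b c k m : 'M[C]_4 := mx4
  [:: [:: a;                    b;                        0;      0];
      [:: expi (2 * k) * b^*;   a + m%:C%C * expi k;      0;      0];
      [:: 0;                    0;                        c%:C%C; 0];
      [:: 0;                    0;                        0;      c%:C%C]].

(** The upper block is [a] times the identity plus the phase [expi k] times a Hermitian matrix, and
    the lower block is a real scalar. The check itself is entrywise. *)
Lemma block_op_normal a b c k m : block_op a b c k m \is normalmx.
Proof.
have e0 := expi_neq0 k.
apply/normalmxP/matrixP => i j; rewrite !mulmx4E.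
elim/ord4_ind: i; elim/ord4_ind: j; rewrite !mxE /= ?expi2 ?expr2 !conjE ?simpE //.
all: by field.
Qed.

Definition block_diag a c k m : 'rV[C]_4 :=
  \row_j [:: a; a + m%:C%C * expi k; c%:C%C; c%:C%C]`_j.

Lemma block_op0 a c k m : block_op a 0 c k m = diag_mx (block_diag a c k m).
Proof.
apply/matrixP => i j; rewrite !mxE.
by elim/ord4_ind: i; elim/ord4_ind: j; rewrite /= ?conjC0 ?mulr0.
Qed.

Section Commutant.
Variables (E0 E1 c k m : R) (a b : C) (X : 'M[C]_4) (mu : C).
Hypothesis E_neq : E0 - E1 <> 0.
Local Notation M := (block_op a b c k m).
Local Notation D := (diag_mx (energies E0 E1)).
Hypothesis MX : M *m X = X *m M.
Hypothesis DX : D *m X - X *m D = mu *: X.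

Let MXe i j : (M *m X) i j = (X *m M) i j. Proof. by rewrite MX. Qed.

Let gap : E0%:C%C - E1%:C%C != 0 :> C.
Proof. by rewrite -rmorphB fmorph_eq0; apply/eqP. Qed.

Lemma commutant_neq0 : b != 0 ->
  X \in <<[:: delta_mx o3 o3; delta_mx o2 o2; delta_mx o3 o2; delta_mx o2 o3;
              rsqrt2 R *: (delta_mx o0 o0 + delta_mx o1 o1)]>>%VS.
Proof.
move=> b0; have eb0 : expi (2 * k) * b^* != 0.
  by rewrite mulf_neq0 ?expi_neq0 // conjC_eq0.
have gap_neq0 z : z = E0%:C%C - E1%:C%C -> z != 0 by move=> ->.
have disj i j p q := diag_mx_commutator_disjoint _ _ _ X mu i j p q DX.
set a' := a + m%:C%C * expi k; set b' := expi (2 * k) * b^*.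
(* The lower block of [M] is the scalar [c], so this column of [X] satisfies the eigenvector
   equation of the upper block at [c]. Its two energy gaps differ by [E0 - E1], so one entry
   vanishes, and the coupling through [b] kills the other. *)
have Xtop (j : 'I_4) : (1 < j)%N -> X o0 j = 0 /\ X o1 j = 0.
  move=> j_gt1; apply: (coupled_vanish _ _ _ a b b' a' c%:C%C) => //.
  - apply: disj; rewrite !mxE -subr_eq0; apply: gap_neq0.
    by elim/ord4_ind: j j_gt1 => //= _; ring.
  - have := MXe o0 j; rewrite !mulmx4E !mxE.
    by elim/ord4_ind: j j_gt1 => //= _; rewrite !simpE => ->; exact: mulrC.
  - have := MXe o1 j; rewrite !mulmx4E !mxE.
    by elim/ord4_ind: j j_gt1 => //= _; rewrite !simpE => ->; exact: mulrC.
(* Same argument on rows; listing [o1] before [o0] keeps the gap difference equal to [E0 - E1] with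
   the right sign. *)
have Xleft (i : 'I_4) : (1 < i)%N -> X i o1 = 0 /\ X i o0 = 0.
  move=> i_gt1; apply: (coupled_vanish _ _ _ a' b b' a c%:C%C) => //.
  - apply: disj; rewrite !mxE -subr_eq0; apply: gap_neq0.
    by elim/ord4_ind: i i_gt1 => //= _; ring.
  - have := MXe i o1; rewrite !mulmx4E !mxE.
    by elim/ord4_ind: i i_gt1 => //= _; rewrite !simpE => ->; rewrite /a'; ring.
  - have := MXe i o0; rewrite !mulmx4E !mxE.
    by elim/ord4_ind: i i_gt1 => //= _; rewrite !simpE => ->; rewrite /b'; ring.
have [[X02 X12] [X03 X13]] := (Xtop o2 isT, Xtop o3 isT).
have [[X21 X20] [X31 X30]] := (Xleft o2 isT, Xleft o3 isT).
have bX : b * X o1 o0 = b' * X o0 o1.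
  have := MXe o0 o0; rewrite !mulmx4E !mxE /= !simpE (mulrC a) => /addrI ->.
  exact: mulrC.
have [X01 X10] : X o0 o1 = 0 /\ X o1 o0 = 0.
  (* The gaps of these two entries are opposite, hence differ by twice [E0 - E1]; [bX] then carries
     the vanishing from one entry to the other. *)
  have [|X01|X10] := disj o0 o1 o1 o0.
  - rewrite !mxE -subr_eq0 /=.
    rewrite [X in X != 0](_ : _ = (E0%:C%C - E1%:C%C) *+ 2); last by ring.
    by rewrite mulrn_eq0.
  - by split=> //; apply/(mulfI b0); rewrite bX X01 !mulr0.
  - by split=> //; apply/(mulfI eb0); rewrite -bX X10 !mulr0.
have X11 : X o1 o1 = X o0 o0.
  have := MXe o0 o1; rewrite !mulmx4E !mxE /= !simpE X01 !simpE => E.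
  by apply: (mulfI b0); rewrite E mulrC.
have r0 := rsqrt2_neq0.
set S := <<_>>%VS.
have -> : X = X o3 o3 *: delta_mx o3 o3 + X o2 o2 *: delta_mx o2 o2 +
    X o3 o2 *: delta_mx o3 o2 + X o2 o3 *: delta_mx o2 o3 +
    (X o0 o0 / rsqrt2 R) *: (rsqrt2 R *: (delta_mx o0 o0 + delta_mx o1 o1)).
  rewrite scalerA divfK //; apply/matrixP => i j.
  by elim/ord4_ind: i; elim/ord4_ind: j; rewrite !mxE /= !simpE.
by rewrite /S !memvD // memvZ // memv_span // !inE eqxx ?orbT.
Qed.
End Commutant.

(** For [b = 0] the operator is diagonal, and the hypotheses make its values [a], [a + m * expi k]
    and [c] pairwise distinct. Entries of [X] survive only between equal values: on the diagonal and
    in the block of the double value [c]. *)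
Lemma commutant_eq0 a c k m (X : 'M[C]_4) :
    a + m%:C%C * expi k != c%:C%C -> m != 0 -> a != c%:C%C ->
    block_op a 0 c k m *m X = X *m block_op a 0 c k m ->
  X \in <<[:: delta_mx o3 o3; delta_mx o2 o2; delta_mx o3 o2; delta_mx o2 o3;
              delta_mx o1 o1; delta_mx o0 o0]>>%VS.
Proof.
move=> a'c m0 ac; rewrite block_op0 => MX.
have a'a : a + m%:C%C * expi k != a.
  by rewrite -subr_eq0 addrC addKr mulf_neq0 ?expi_neq0 // fmorph_eq0.
have X0 i j : block_diag a c k m 0 i != block_diag a c k m 0 j ->
    X i j = 0 /\ X j i = 0.
  move=> ij; have entry p q : block_diag a c k m 0 p != block_diag a c k m 0 q ->
    X p q = 0.
    move=> pq; have := diag_mx_commutatorE _ _ (block_diag a c k m) X p q.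
    rewrite MX subrr mxE => /esym/eqP.
    by rewrite mulf_eq0 subr_eq0 (negPf pq) => /eqP.
  by split; apply: entry; rewrite // eq_sym.
have [X10 X01] : X o1 o0 = 0 /\ X o0 o1 = 0 by apply: X0; rewrite !mxE.
have [X02 X20] : X o0 o2 = 0 /\ X o2 o0 = 0 by apply: X0; rewrite !mxE.
have [X03 X30] : X o0 o3 = 0 /\ X o3 o0 = 0 by apply: X0; rewrite !mxE.
have [X12 X21] : X o1 o2 = 0 /\ X o2 o1 = 0 by apply: X0; rewrite !mxE.
have [X13 X31] : X o1 o3 = 0 /\ X o3 o1 = 0 by apply: X0; rewrite !mxE.
set S := <<_>>%VS.
have -> : X = X o3 o3 *: delta_mx o3 o3 + X o2 o2 *: delta_mx o2 o2 +
    X o3 o2 *: delta_mx o3 o2 + X o2 o3 *: delta_mx o2 o3 +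
    X o1 o1 *: delta_mx o1 o1 + X o0 o0 *: delta_mx o0 o0.
  apply/matrixP => i j.
  by elim/ord4_ind: i; elim/ord4_ind: j; rewrite !mxE /= !simpE.
by rewrite /S !memvD // memvZ // memv_span // !inE eqxx ?orbT.
Qed.

(** * The listed elements as eigenvectors, in the frame of [T2] *)

Section Frame.
Variables (E0 E1 c k m : R) (a b : C).
Local Notation M := (block_op a b c k m).
Local Notation D := (diag_mx (energies E0 E1)).
Let dE : C := (E0 - E1)%:C%C.

Lemma energies_hermitian : D ^t* = D.
Proof.
rewrite tr_diag_mx map_diag_mx; congr diag_mx; apply/matrixP => i j.
by elim/ord4_ind: j; rewrite !mxE /= !conjCD !conj_real.
Qed.

(** Indices above 1 select the block where [M] is the scalar [c]. *)
Lemma block_op_comm_delta (i j : 'I_4) : (1 < i)%N -> (1 < j)%N ->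
  M *m delta_mx i j = delta_mx i j *m M.
Proof.
move=> i_gt1 j_gt1; apply/matrixP => p q; rewrite !mulmx4E.
by elim/ord4_ind: i i_gt1; elim/ord4_ind: j j_gt1 => // _ _;
  elim/ord4_ind: p; elim/ord4_ind: q; rewrite !mxE /= !simpE.
Qed.

Lemma block_op_comm_Qt :
  M *m (delta_mx o0 o0 + delta_mx o1 o1) = (delta_mx o0 o0 + delta_mx o1 o1) *m M.
Proof.
apply/matrixP => p q; rewrite !mulmx4E.
by elim/ord4_ind: p; elim/ord4_ind: q; rewrite !mxE /= !simpE.
Qed.

Lemma block_op_comm_diag i :
  block_op a 0 c k m *m delta_mx i i = delta_mx i i *m block_op a 0 c k m.
Proof.
apply/eqP; rewrite block_op0 -subr_eq0 diag_mx_commutator_delta.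
by rewrite subrr scale0r.
Qed.

Lemma Re_imaginary (x : R) : 'Re ('i * x%:C%C) = 0 :> C.
Proof. by rewrite ReE conjCM conjCi conj_real mulNr subrr mul0r. Qed.

(** These four elements are common to both cases. The sign of the eigenvalue comes from the gap of
    [(o3, o2)], which is [E1 - E0 = 'i * ('i * dE)]. *)
Lemma protected_eigenvectors X l :
  (X, l) \in [:: (delta_mx o3 o3, 0); (delta_mx o2 o2, 0);
     (delta_mx o3 o2, 'i * dE); (delta_mx o2 o3, - ('i * dE))] ->
  [/\ 'Re l = 0, M *m X = X *m M & D *m X - X *m D = ('i * l) *: X].
Proof.
have dEE : dE = E0%:C%C - E1%:C%C by rewrite /dE rmorphB.
have ii : 'i * 'i = -1 :> C by rewrite -expr2 sqrCi.
rewrite !inE => /or4P[] /eqP[-> ->];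
  rewrite block_op_comm_delta // diag_mx_commutator_delta; split=> //;
  rewrite ?raddf0 ?raddfN /= ?Re_imaginary ?oppr0 //;
  apply: (congr1 ( *:%R^~ _)); rewrite !mxE /= ?mulrN ?mulrA ?ii ?dEE; ring.
Qed.

Lemma delta_diag_stationary i :
  D *m delta_mx i i - delta_mx i i *m D = ('i * 0) *: delta_mx i i.
Proof. by rewrite diag_mx_commutator_delta subrr mulr0. Qed.

Lemma Qt_stationary (X := rsqrt2 R *: (delta_mx o0 o0 + delta_mx o1 o1)) :
  [/\ 'Re 0 = 0 :> C, M *m X = X *m M & D *m X - X *m D = ('i * 0) *: X].
Proof.
split; first by rewrite raddf0.
  by rewrite /X -scalemxAr -scalemxAl block_op_comm_Qt.
rewrite /X -scalemxAr -scalemxAl -scalerBr mulmxDr mulmxDl opprD addrACA.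
by rewrite !delta_diag_stationary mulr0 !scale0r addr0 scaler0.
Qed.

Lemma hs_orthonormal_delta (s : seq ('I_4 * 'I_4)) : uniq s ->
  hs_orthonormal [seq delta_mx p.1 p.2 : 'M[C]_4 | p <- s].
Proof.
move=> s_uniq i j; rewrite size_map => i_lt j_lt.
rewrite !(nth_map (o0, o0)) // hs_dot_delta -xpair_eqE -!surjective_pairing.
by rewrite nth_uniq.
Qed.

End Frame.

End TwoQubits.

(** * Assembly of the two bases *)

Theorem mainTheorem6 (R : realType) (E0 E1 phi : R) (a b : R[i]) (c k m : R)
    (hE : E0 - E1 <> 0) (hphi : 0 <= phi < 2 * pi) :
  let H := hamiltonian E0 E1 in
  let L := lindblad_op phi a b c k m in
  let dE : R[i] := (E0 - E1)%:C%C in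
  let v11 := ket11 R in
  let v00 := ket00 R in
  let p1 := psi1 phi in
  let p2 := psi2 phi in
  (b <> 0 ->
     attractor_onb H L
       [:: (ketbra v11 v11, 0);
           (ketbra p1 p1, 0);
           (ketbra v11 p1, 'i * dE);
           (ketbra p1 v11, - ('i * dE));
           (rsqrt2 R *: Qt phi, 0)])
  /\
  (b = 0 -> a + m%:C%C * expi k <> c%:C%C -> m <> 0 -> a <> c%:C%C ->
     attractor_onb H L
       [:: (ketbra v11 v11, 0);
           (ketbra p1 p1, 0);
           (ketbra v11 p1, 'i * dE);
           (ketbra p1 v11, - ('i * dE));
           (ketbra p2 p2, 0);
           (ketbra v00 v00, 0)]).
Proof.
(* Operators and basis elements all become conjugates by [T2], the ketbras being images of matrix
   units. *)
rewrite /Qt (ket00E _ phi) (ket11E _ phi) psi1E psi2E.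
rewrite !ketbraM !ketbra_delta (hamiltonian_T2 _ phi) /=.
rewrite -[lindblad_op _ _ _ _ _ _]/(T2 phi *m block_op _ a b c k m *m (T2 phi) ^t*).
have DH := energies_hermitian R E0 E1; have Mn := block_op_normal _ a b c k m.
have Uu := T2_unitary _ phi.
split=> [b0 | b0 a'c m0 ac]; last rewrite b0 in Mn *.
  pose B : seq ('M[R[i]]_4 * R[i]) := [:: (delta_mx o3 o3, 0); (delta_mx o2 o2, 0);
    (delta_mx o3 o2, 'i * (E0 - E1)%:C%C); (delta_mx o2 o3, - ('i * (E0 - E1)%:C%C));
    (rsqrt2 R *: (delta_mx o0 o0 + delta_mx o1 o1), 0)].
  have := @attractor_onb_conj _ _ (T2 phi) _ _ B Uu DH Mn.
  rewrite /B /= -!scalemxAr -!scalemxAl mulmxDr mulmxDl; apply.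
  - apply: (hs_orthonormal_rcons _ _ [:: _; _; _; _] _ (hs_orthonormal_delta _
      [:: (o3, o3); (o2, o2); (o3, o2); (o2, o3)] _)) => // [Y|].
      rewrite !inE => /or4P[] /eqP->;
        by rewrite hs_dotZr hs_dotDr !hs_dot_delta addr0 mulr0.
    (* The sum of two diagonal units has squared norm 2, which the factor [rsqrt2] normalizes to
       1. *)
    rewrite hs_dotZr hs_dotDr !(hs_dotC _ _ _ (_ *: _)).
    rewrite !hs_dotZr !hs_dotDr !hs_dot_delta /=.
    rewrite addr0 add0r !mulr1 conj_rsqrt2 mulrDr !rsqrt2M; by field.
  (* Splitting after four entries isolates the elements covered by [protected_eigenvectors]. *)
  - move=> X l; rewrite -[_ :: _]/(take 4 B ++ drop 4 B) mem_cat => /orP[].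
      exact: protected_eigenvectors.
    by rewrite inE => /eqP[-> ->]; exact: Qt_stationary.
  - move=> X mu MX DX; apply: (commutant_neq0 _ _ _ _ _ _ _ _ _ _ hE MX DX).
    exact/eqP.
pose B : seq ('M[R[i]]_4 * R[i]) := [:: (delta_mx o3 o3, 0); (delta_mx o2 o2, 0);
  (delta_mx o3 o2, 'i * (E0 - E1)%:C%C); (delta_mx o2 o3, - ('i * (E0 - E1)%:C%C));
  (delta_mx o1 o1, 0); (delta_mx o0 o0, 0)].
apply: (@attractor_onb_conj _ _ (T2 phi) _ _ B Uu DH Mn).
- exact: (hs_orthonormal_delta _
    [:: (o3, o3); (o2, o2); (o3, o2); (o2, o3); (o1, o1); (o0, o0)]).
- move=> X l; rewrite -[B]/(take 4 B ++ drop 4 B) mem_cat => /orP[].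
    exact: protected_eigenvectors.
  by rewrite !inE => /orP[] /eqP[-> ->]; rewrite raddf0; split=> //;
    by [exact: block_op_comm_diag | exact: delta_diag_stationary].
- by move=> X mu MX _; apply: commutant_eq0 MX; apply/eqP.
Qed.
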